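(* Let $x_1,\dots,x_n\in(0,1]$ be such that $x_1=\min_{1\le i\le n}x_i$ and $x_n=\max_{1\le i\le n}x_i$, let $p_1,\dots,p_n\in[0,1]$ with $\sum_{i=1}^n p_i=1$, and for each $i$ let $\lambda_i\in[0,1]$ be such that $x_i=\lambda_i x_1+(1-\lambda_i)x_n$. Put $A=\sum_{i=1}^n p_ix_i$, $G=\prod_{i=1}^n x_i^{p_i}$, $\widetilde{A}=x_1+x_n-A$, $\widetilde{G}=\dfrac{x_1x_n}{G}$, and $$M=2\sum_{i=1}^n p_i\lambda_i(1-\lambda_i)(x_1-x_n)^2+\sum_{i=1}^n p_i\Big(x_i-\sum_{j=1}^n p_jx_j\Big)^2 .$$ Then $$-\ln\widetilde{A}\le-\ln\widetilde{G}-\tfrac12 M\le-\ln\widetilde{G},$$ and hence $$\widetilde{G}\le e^{\frac12 M}\,\widetilde{G}\le\widetilde{A}.$$ *)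

(* Defs.v *)
From mathcomp Require Import all_boot all_order all_algebra.
From mathcomp Require Import reals exp.

Set Implicit Arguments.
Unset Strict Implicit.
Unset Printing Implicit Defensive.

Import Order.TTheory GRing.Theory Num.Theory.
Local Open Scope ring_scope.

(* A family x_1, ..., x_m with m >= 1 is a function on 'I_n.+1 with m = n.+1;
   x_1 is [x ord0] and x_m is [x ord_max]. *)

Section MercerMeans.
Variables (R : realType) (n : nat).
Implicit Types x p lam : 'I_n.+1 -> R.

Definition amean p x : R := \sum_i p i * x i.

Definition gmean p x : R := \prod_i x i `^ p i.

Definition mercer_amean p x : R := x ord0 + x ord_max - amean p x.

Definition mercer_gmean p x : R := x ord0 * x ord_max / gmean p x.

Definition mercer_gap p lam x : R :=
  2 * (\sum_i p i * lam i * (1 - lam i) * (x ord0 - x ord_max) ^+ 2)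
  + \sum_i p i * (x i - \sum_j p j * x j) ^+ 2.

End MercerMeans.

(* Main.v *)
Require Import Defs.
From mathcomp Require Import all_boot all_order all_algebra.
From mathcomp Require Import ring lra.
From mathcomp Require Import classical_sets reals topology normedtype derive.
From mathcomp Require Import sequences exp.

Import Order.TTheory GRing.Theory Num.Theory numFieldNormedType.Exports.
Local Open Scope ring_scope.

(** Since [(- ln)'' t = t^-2 >= 1] on [(0, 1]], the function [- ln] is strongly
    convex there with modulus 1, that is, [t |-> - ln t - t ^+ 2 / 2] is convex.
    Everything follows from this, in the form of a tangent-line bound with a
    quadratic correction ([ln_le_tangent_sq]).

    Averaging that bound at the barycentre [m] of points [y i] cancels the linear
    term and leaves Jensen's inequality improved by half the variance of [y]
    ([ln_jensen_variance]).  For two points of weights [l] and [1 - l] the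
    variance is [l * (1 - l) * (a - b) ^+ 2].

    For each [i], both [x i] and its reflection [y i = a + b - x i] are
    barycentres of [a = x ord0] and [b = x ord_max], with the two weights
    exchanged.  Adding the two-point inequalities gives Mercer's inequality
    [ln a + ln b <= ln (x i) + ln (y i) - l * (1 - l) * (a - b) ^+ 2]
    ([ln_mercer_pair]).  Averaging over [i] with weights [p i], and then applying
    the improved Jensen inequality to the [y i], whose mean is [a + b - A] and
    whose variance is that of the [x i], yields
    [- ln At <= - ln Gt - M / 2].  The statement on the means themselves is its
    exponential. *)

Section StrongConcavityLn.
Set Implicit Arguments.
Unset Strict Implicit.
Variable R : realType.

(** The difference [ln t - t / s + (t - s) ^+ 2 / 2] has derivative
    [(t - s) * (1 - (s * t)^-1)] in [t]; as [s * t <= 1], it is maximal at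
    [t = s]. *)
Lemma ln_le_tangent_sq (s t : R) : 0 < s <= 1 -> 0 < t <= 1 ->
  ln t <= ln s + (t - s) / s - (t - s) ^+ 2 / 2.
Proof.
move=> /andP[s0 s1] /andP[t0 t1].
pose h (u : R) : R := ln u - u / s + (u - s) ^+ 2 / 2.
pose dh (u : R) : R := u^-1 - s^-1 + (u - s).
have hd (u : R) : 0 < u -> is_derive u 1 h (dh u).
  move=> u0; rewrite /h /dh.
  have dln := is_derive1_ln u0.
  apply: is_derive_eq.
  rewrite /GRing.scale/= !(mulr0, mul0r, mulr1, mul1r, addr0, add0r, subr0).
  field; lra.
have hc (u v : R) : 0 < u -> {within `[u, v], continuous h}%classic.
  move=> u0; apply: derivable_within_continuous => w.
  rewrite in_itv/= => /andP[uw _].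
  by apply: ex_derive; apply: hd; exact: lt_le_trans uw.
have dhE c : 0 < c -> dh c = (c - s) * (1 - (s * c)^-1).
  by move=> c0; rewrite /dh; field; rewrite ?gt_eqF.
have inv_sc_ge1 c : 0 < c -> c <= 1 -> 1 <= (s * c)^-1.
  move=> c0 c1; rewrite invf_ge1 ?mulr_gt0//.
  by rewrite mulr_ile1// ltW.
suff hts : h t <= h s.
  have ss : s / s = 1 by rewrite divff ?gt_eqF.
  by move: hts; rewrite /h mulrBl ss; lra.
have [st|/ltW ts] := leP s t.
- have [|c] := @MVT_segment R h dh s t st _ (hc _ _ s0).
    by move=> u; rewrite in_itv/= => /andP[su _]; apply: hd; exact: lt_trans su.
  rewrite in_itv/= => /andP[sc ct] E.
  have c0 : 0 < c by exact: lt_le_trans sc.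
  rewrite -subr_le0 E mulr_le0_ge0 ?subr_ge0// dhE//.
  rewrite mulr_ge0_le0 ?subr_ge0 ?subr_le0//.
  by rewrite inv_sc_ge1// (le_trans ct).
- have [|c] := @MVT_segment R h dh t s ts _ (hc _ _ t0).
    by move=> u; rewrite in_itv/= => /andP[tu _]; apply: hd; exact: lt_trans tu.
  rewrite in_itv/= => /andP[tc cs] E.
  have c0 : 0 < c by exact: lt_le_trans tc.
  rewrite -subr_ge0 E mulr_ge0 ?subr_ge0// dhE// mulr_le0 ?subr_le0//.
  by rewrite inv_sc_ge1// (le_trans cs).
Qed.

Lemma mean_itv01 (I : finType) (q y : I -> R) :
  (forall i, 0 <= q i) -> \sum_i q i = 1 -> (forall i, 0 < y i <= 1) ->
  0 < \sum_i q i * y i <= 1.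
Proof.
move=> q0 q1 y01; apply/andP; split; last first.
  rewrite -q1; apply: ler_sum => i _.
  by have /andP[_ yi1] := y01 i; rewrite ler_piMr.
have qy0 i : 0 <= q i * y i.
  by have /andP[/ltW yi0 _] := y01 i; rewrite mulr_ge0.
rewrite lt_def sumr_ge0// andbT; apply/eqP => m0.
have /eqP := q1; rewrite big1 ?(eq_sym 0) ?oner_eq0// => i _.
have /eqP := psumr_eq0P (P := predT) (fun i _ => qy0 i) m0 (isT : predT i).
by have /andP[/gt_eqF yi0 _] := y01 i; rewrite mulf_eq0 yi0 orbF => /eqP.
Qed.

(** Average the tangent bound at [s = m]: the linear terms [q i * (y i - m) / m]
    sum to zero. *)
Lemma ln_jensen_variance (I : finType) (q y : I -> R)
    (m := \sum_i q i * y i) :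
  (forall i, 0 <= q i) -> \sum_i q i = 1 -> (forall i, 0 < y i <= 1) ->
  \sum_i q i * ln (y i) <= ln m - (\sum_i q i * (y i - m) ^+ 2) / 2.
Proof.
move=> q0 q1 y01.
have m01 : 0 < m <= 1 by exact: mean_itv01.
apply: (@le_trans _ _
  (\sum_i q i * (ln m + (y i - m) / m - (y i - m) ^+ 2 / 2))).
  by apply: ler_sum => i _; rewrite ler_wpM2l// ln_le_tangent_sq.
have split_term i : q i * (ln m + (y i - m) / m - (y i - m) ^+ 2 / 2)
    = q i * ln m + (q i * y i - q i * m) / m - q i * (y i - m) ^+ 2 / 2.
  by ring.
rewrite (eq_bigr _ (fun i _ => split_term i)) sumrB big_split/= -!mulr_suml.
by rewrite sumrB -mulr_suml q1 !mul1r subrr mul0r addr0.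
Qed.

Lemma ln_two_point (l a b : R) :
  0 <= l <= 1 -> 0 < a <= 1 -> 0 < b <= 1 ->
  l * ln a + (1 - l) * ln b
    <= ln (l * a + (1 - l) * b) - l * (1 - l) * (a - b) ^+ 2 / 2.
Proof.
move=> l01 a01 b01.
set m := l * a + (1 - l) * b.
have var_m :
    l * (a - m) ^+ 2 + (1 - l) * (b - m) ^+ 2 = l * (1 - l) * (a - b) ^+ 2.
  by rewrite /m; ring.
have := @ln_jensen_variance bool (fun c => if c then l else 1 - l)
  (fun c => if c then a else b).
rewrite /= !big_bool/= -/m var_m.
by apply; [case; lra | ring | case].
Qed.

(** The point [x] and its reflection [a + b - x] are barycentres of [a] and [b]
    with exchanged weights, so the two instances of [ln_two_point] add up. *)
Lemma ln_mercer_pair (l a b x : R) :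
  0 <= l <= 1 -> 0 < a <= 1 -> 0 < b <= 1 -> x = l * a + (1 - l) * b ->
  ln a + ln b <= ln x + ln (a + b - x) - l * (1 - l) * (a - b) ^+ 2.
Proof.
move=> l01 a01 b01 ->.
have l'01 : 0 <= 1 - l <= 1 by lra.
have h1 := ln_two_point l01 a01 b01.
have h2 := ln_two_point l'01 a01 b01.
have -> :
    a + b - (l * a + (1 - l) * b) = (1 - l) * a + (1 - (1 - l)) * b by ring.
lra.
Qed.

End StrongConcavityLn.

Section GeometricMean.
Set Implicit Arguments.
Unset Strict Implicit.
Variables (R : realType) (n : nat).
Implicit Types p x : 'I_n.+1 -> R.

Lemma gmean_gt0 p x : (forall i, 0 < x i) -> 0 < gmean p x.
Proof. by move=> x0; apply: prodr_gt0 => i _; rewrite powR_gt0. Qed.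

Lemma ln_gmean p x : (forall i, 0 < x i) ->
  ln (gmean p x) = \sum_i p i * ln (x i).
Proof.
move=> x0.
(* Positivity is carried along the induction because [lnM] requires it of both
   factors. *)
suff [] : 0 < gmean p x /\ ln (gmean p x) = \sum_i p i * ln (x i) by [].
rewrite /gmean; elim/big_ind2: _ => [|u1 v1 u2 v2 [? <-] [? <-]|i _].
- by rewrite ln1.
- by rewrite mulr_gt0// lnM.
- by rewrite powR_gt0// ln_powR.
Qed.

End GeometricMean.

Theorem corollary2p2 (R : realType) (n : nat) (x p lam : 'I_n.+1 -> R)
  (x_itv : forall i, 0 < x i <= 1)
  (x_min : forall i, x ord0 <= x i)
  (x_max : forall i, x i <= x ord_max)
  (p_itv : forall i, 0 <= p i <= 1)
  (p_sum : \sum_i p i = 1)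
  (lam_itv : forall i, 0 <= lam i <= 1)
  (x_lam : forall i, x i = lam i * x ord0 + (1 - lam i) * x ord_max) :
  let At := mercer_amean p x in
  let Gt := mercer_gmean p x in
  let M := mercer_gap p lam x in
  - ln At <= - ln Gt - 1 / 2 * M <= - ln Gt /\
  Gt <= expR (1 / 2 * M) * Gt <= At.
Proof.
move=> At Gt M.
have x0 i : 0 < x i by have /andP[] := x_itv i.
have p0 i : 0 <= p i by have /andP[] := p_itv i.
pose a := x ord0; pose b := x ord_max.
pose y i := a + b - x i.
have y_itv i : 0 < y i <= 1.
  have := x_min i; have := x_max i; have := x_itv ord0; have := x_itv ord_max.
  by rewrite /y /a /b; lra.
have AtE : At = \sum_i p i * y i.
  under eq_bigr => i _ do rewrite /y mulrBr.
  by rewrite sumrB -mulr_suml p_sum mul1r.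
have At0 : 0 < At by rewrite AtE; have /andP[] := mean_itv01 p0 p_sum y_itv.
have Gt0 : 0 < Gt by rewrite divr_gt0 ?mulr_gt0 ?gmean_gt0.
pose S := \sum_i p i * lam i * (1 - lam i) * (a - b) ^+ 2.
pose V := \sum_i p i * (x i - \sum_j p j * x j) ^+ 2.
have ME : M = 2 * S + V by [].
have S0 : 0 <= S.
  apply: sumr_ge0 => i _; have /andP[l0 l1] := lam_itv i.
  by apply: mulr_ge0 (sqr_ge0 _); rewrite !mulr_ge0 ?subr_ge0.
have V0 : 0 <= V by apply: sumr_ge0 => i _; rewrite mulr_ge0 ?sqr_ge0.
have M0 : 0 <= M by rewrite ME; lra.
have lnGt : ln Gt = ln a + ln b - \sum_i p i * ln (x i).
  by rewrite ln_div ?posrE ?mulr_gt0 ?gmean_gt0// lnM ?posrE// ln_gmean.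
have mercer :
    ln a + ln b <= \sum_i p i * ln (x i) + \sum_i p i * ln (y i) - S.
  have -> : ln a + ln b = \sum_i p i * (ln a + ln b).
    by rewrite -mulr_suml p_sum mul1r.
  rewrite -big_split/= -sumrB.
  apply: ler_sum => i _.
  have := ln_mercer_pair (lam_itv i) (x_itv ord0) (x_itv ord_max) (x_lam i).
  rewrite -/a -/b -/(y i) => /(ler_wpM2l (p0 i)); lra.
have jensen : \sum_i p i * ln (y i) <= ln At - V / 2.
  have /= := ln_jensen_variance p0 p_sum y_itv; rewrite -AtE.
  (* Reflection preserves the variance: [y i - At] is the opposite of
     the deviation of [x i] from its mean. *)
  congr (_ <= _ - _ / 2); apply: eq_bigr => i _; congr (_ * _).
  by rewrite /At /mercer_amean /amean /y /a /b; ring.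
have key : ln Gt + 1 / 2 * M <= ln At by rewrite lnGt ME; lra.
split; first by apply/andP; split; lra.
have halfM0 : 0 <= 1 / 2 * M by lra.
apply/andP; split; first by rewrite ler_peMl ?(ltW Gt0)// -[leLHS]expR0 ler_expR.
have eGt0 : 0 < expR (1 / 2 * M) * Gt by exact: mulr_gt0 (expR_gt0 _) Gt0.
by rewrite -ler_ln// lnM ?posrE ?expR_gt0// expRK addrC.
Qed.
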